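(* There exist finite groups $G_n$ of arbitrarily large order $n$, along with corresponding Cayley graphs $\Gamma_n$ of $G_n$ and consistent $G_n$-invariant path systems $\mathcal{P}_n$ in $\Gamma_n$, with $\Delta(\mathcal{P}_n)\ge\tilde{\Omega}(\sqrt{n})$. That is, there are absolute constants $c>0$ and $k\ge 0$ such that for infinitely many $n$ there exist a group $G_n$ of order $n$, a Cayley graph $\Gamma_n$ of $G_n$ and a consistent $G_n$-invariant path system $\mathcal{P}_n$ in $\Gamma_n$ with $\Delta(\mathcal{P}_n)\ge c\,\sqrt{n}/(\log n)^k$.
   Context: For a group $G$ and a generating set $S=S^{-1}\subset G$, the Cayley graph $\Gamma(G,S)$ has vertex set $G$ and edges $\{g,gs\}$ for $g\in G$, $s\in S$. Let $\Gamma=(V,E)$ be a finite connected graph. A consistent path system $\mathcal{P}$ in $\Gamma$ is a collection of simple paths in $\Gamma$ such that: (1) for every $u,v\in V$ there is a unique path $P_{u,v}\in\mathcal{P}$ connecting $u$ and $v$, with $P_{u,v}=P_{v,u}$ as undirected paths ($P_{u,u}$ being the trivial one-vertex path); (2) if $P\in\mathcal{P}$ and $x,y$ are vertices of $P$, then the $(xy)$-subpath of $P$ is $P_{x,y}\in\mathcal{P}$. For a path $P=(h_1,\dots,h_k)$ in a Cayley graph of $G$ and $g\in G$ put $gP=(gh_1,\dots,gh_k)$. A path system $\mathcal{P}$ in a Cayley graph of $G$ is $G$-invariant if $gP_{x,y}=P_{gx,gy}$ for all $g,x,y\in G$. For a metric $\rho$ on $V$ and a path $P=(x_0,\dots,x_k)$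 put $\rho(P)=\sum_{i=1}^k\rho(x_{i-1},x_i)$. For real $\alpha\ge 1$, $\mathcal{P}$ is $\alpha$-metric if there is a metric $\rho$ on $V$ with $\rho(u,v)\le\rho(P_{u,v})\le\alpha\,\rho(u,v)$ for all $P_{u,v}\in\mathcal{P}$. Define $\Delta(\mathcal{P})=\inf\{\alpha\ge 1:\mathcal{P}\text{ is }\alpha\text{-metric}\}$. The notation $\tilde\Omega$ hides polylogarithmic factors in $n$. *)

(* Defs.v *)
From HB Require Import structures.
From mathcomp Require Import all_boot all_order all_algebra all_fingroup.
From mathcomp Require Import all_classical all_reals all_analysis.

Set Implicit Arguments.
Unset Strict Implicit.
Unset Printing Implicit Defensive.

Import Order.TTheory GRing.Theory Num.Theory.
Local Open Scope classical_set_scope.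
Local Open Scope ring_scope.

(* The adjacency relation of a graph on [T] is a [rel T], and a path is the
   sequence of all the vertices it visits.  Undirected paths are oriented: a
   sequence and its reversal stand for the same path. *)

Definition simple_path (T : eqType) (e : rel T) (u v : T) (p : seq T) : Prop :=
  exists q : seq T, [/\ p = u :: q, path e u q, last u q = v & uniq p].

(* For [p] without repetition and [x], [y] on [p]: the part of [p] between
   [x] and [y], oriented from [x] to [y]. *)
Definition subpath (T : eqType) (p : seq T) (x y : T) : seq T :=
  let i := index x p in let j := index y p in
  if (i <= j)%N then drop i (take j.+1 p) else rev (drop j (take i.+1 p)).

(* A system is given by the map [(u, v) |-> P_{u,v}], with [P u v] oriented
   from [u] to [v]; that there is exactly one path for each pair of endpoints is
   built in, and simplicity forces [P u u = [:: u]]. *)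
Definition path_system (T : eqType) := T -> T -> seq T.

Definition consistent_path_system (T : finType) (e : rel T)
    (P : path_system T) : Prop :=
  [/\ forall u v, simple_path e u v (P u v),
      forall u v, P v u = rev (P u v)
    & forall u v x y, x \in P u v -> y \in P u v -> subpath (P u v) x y = P x y].

Definition symmetric_generating_set (gT : finGroupType) (S : {set gT}) : Prop :=
  (S^-1)%g = S /\ <<S>>%g = [set: gT]%SET.

(* If [1 \in S] this relation has loops, which no simple path uses. *)
Definition cayley_graph (gT : finGroupType) (S : {set gT}) : rel gT :=
  fun g h => [exists s in S, h == (g * s)%g].

Definition invariant_path_system (gT : finGroupType) (P : path_system gT) : Prop :=
  forall g x y : gT, [seq (g * h)%g | h <- P x y] = P (g * x)%g (g * y)%g.

Definition is_metric (R : realType) (T : Type) (rho : T -> T -> R) : Prop :=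
  [/\ forall x y, 0 <= rho x y,
      forall x y, rho x y = 0 <-> x = y,
      forall x y, rho x y = rho y x
    & forall x y z, rho x z <= rho x y + rho y z].

Definition path_length (R : realType) (T : Type) (rho : T -> T -> R)
    (p : seq T) : R :=
  \sum_(xy <- zip p (behead p)) rho xy.1 xy.2.

Definition alpha_metric (R : realType) (T : finType) (P : path_system T)
    (alpha : R) : Prop :=
  exists2 rho : T -> T -> R, is_metric rho &
    forall u v, rho u v <= path_length rho (P u v) <= alpha * rho u v.

Definition Delta (R : realType) (T : finType) (P : path_system T) : R :=
  inf [set alpha : R | 1 <= alpha /\ alpha_metric P alpha].

(* Main.v *)
Require Import Defs.
From HB Require Import structures.
From mathcomp Require Import all_boot all_order all_algebra all_fingroup.
From mathcomp Require Import all_classical all_reals all_analysis.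
From mathcomp Require Import zify lra.

Set Implicit Arguments.
Unset Strict Implicit.
Unset Printing Implicit Defensive.

Import Order.TTheory GRing.Theory Num.Theory.
Local Open Scope ring_scope.

(** The group is the cyclic group Z/n with n = M^2 + 1, and all of its elements
are generators.  Since M^2 = -1 modulo n, multiplication by M is a quarter turn
of Z/n, and the orbit of 1 is A = {1, M, -1, -M}.  Modulo n, the progressions
z, 2z, ..., (M-1)z for z in A have no term in common
([quarter_turns_independent]).  So the path from u to u + jz may be chosen to be
u, u + z, ..., u + jz whenever z is in A and j < M, and the path between two
vertices whose difference has no such form may be a single edge.  This system is
consistent and invariant, because a subpath or a reversal of a progression with
step in A is again one ([ray_factorization], [power_path_consistent]).

It is far from metric.  Let rho witness that it is a-metric, and average rho
over translations: w(g) = sum_u rho(u, u + g) is symmetric, subadditive and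
positive away from 0, and the path to jz gives j w(z) <= a w(jz)
([average_power_path]).  But the far ends of the two long progressions are only
two steps away from 0 when both steps may be used:
  (M-1) 1 = M - 1   and   (M-1) M = - M - 1.
Hence (M-1) w(1) and (M-1) w(M) are both at most a (w(1) + w(M)), and adding the
two gives a >= (M-1)/2 ([le_Delta_rays]), which is of order the square root of
n; no logarithm is lost. *)

(** * Paths given as enumerated sequences *)

Lemma subpath_sym (T : eqType) (p : seq T) (x y : T) :
  subpath p y x = rev (subpath p x y).
Proof.
rewrite /subpath; case: ltngtP => [_|_|->]; rewrite ?revK //.
have : (size (drop (index x p) (take (index x p).+1 p)) <= 1)%N.
  by rewrite size_drop size_take_min; lia.
by case: (drop _ _) => [|a [|b s]].
Qed.

Lemma subpath_mkseq (T : eqType) (f : nat -> T) (n i j : nat) :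
  {in gtn n &, injective f} -> (i <= j < n)%N ->
  subpath (mkseq f n) (f i) (f j) = mkseq (fun t => f (i + t)%N) (j - i).+1.
Proof.
move=> finj /andP[leij ltjn].
have indexf k : (k < n)%N -> index (f k) (mkseq f n) = k.
  move=> ltkn; rewrite -(nth_mkseq (f 0) f ltkn) index_uniq ?size_mkseq //.
  by apply/mkseq_uniqP.
rewrite /subpath !indexf ?leij //; last exact: leq_ltn_trans ltjn.
rewrite /mkseq -map_take take_iota -map_drop drop_iota add0n.
have -> : (minn j.+1 n - i = (j - i).+1)%N by lia.
by rewrite -{1}[i]addn0 iotaDl -map_comp.
Qed.

Lemma path_length_mkseq (R : realType) (T : Type) (rho : T -> T -> R)
    (f : nat -> T) (k : nat) :
  path_length rho (mkseq f k.+1) = \sum_(0 <= i < k) rho (f i) (f i.+1).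
Proof.
elim: k f => [|k IHk] f.
  by rewrite big_geq // /path_length big_nil.
rewrite big_nat_recl // -(IHk (f \o S)) /path_length /mkseq /= big_cons /=.
by rewrite -[2%N]/(1 + 1)%N iotaDl -map_comp.
Qed.

(** * Bounding Delta from below *)

Lemma path_length_le_size (R : realType) (T : Type) (rho : T -> T -> R) p :
  (forall x y, rho x y <= 1) -> path_length rho p <= (size p)%:R.
Proof.
move=> rho1; rewrite /path_length.
apply: (@le_trans _ _ (size (zip p (behead p)))%:R); last first.
  by rewrite ler_nat size_zip geq_minl.
rewrite -[leRHS]mulr1n -sum1_size natr_sum; apply: ler_sum => xy _.
exact: rho1.
Qed.

Lemma le_path_length (R : realType) (T : Type) (rho : T -> T -> R) u q :
  is_metric rho -> rho u (last u q) <= path_length rho (u :: q).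
Proof.
case=> rho0 rhoE _ rhoD; rewrite /path_length /=.
elim: q u => [|v q IHq] u /=; first by rewrite big_nil (rhoE u u).2.
rewrite big_cons /=; apply: le_trans (rhoD u v _) _.
by rewrite lerD2l.
Qed.

Lemma discrete_metric (R : realType) (T : eqType) :
  is_metric (fun x y : T => (x != y)%:R : R).
Proof.
split=> [x y|x y|x y|x y z]; rewrite ?ler0n //.
- by case: eqVneq => [->|/eqP ne]; split=> // /eqP; rewrite ?oner_eq0.
- by rewrite eq_sym.
- rewrite -natrD ler_nat.
  case: (eqVneq x y) => [->|_] //=.
  exact: leq_trans (leq_b1 _) (leq_addr _ _).
Qed.

(** As [inf set0 = 0], a lower bound for [Delta] requires some [alpha] to be
admissible.  One always is: in the discrete metric a path is at most as long as
the number of its vertices. *)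
Lemma le_Delta (R : realType) (T : finType) (e : rel T) (P : path_system T)
    (b : R) :
  (forall u v, simple_path e u v (P u v)) ->
  (forall a, 1 <= a -> alpha_metric P a -> b <= a) -> b <= Delta R P.
Proof.
move=> Psimple lb; apply: lb_le_inf; last by move=> a [a1 Pa]; exact: lb.
exists #|T|.+1%:R; split; first by rewrite ler1n.
exists (fun x y : T => (x != y)%:R); first exact: discrete_metric.
move=> u v; have [q [Pq _ lastq uniqq]] := Psimple u v.
apply/andP; split.
  by rewrite Pq -[v in leLHS]lastq le_path_length //; exact: discrete_metric.
have [uv|neuv] := eqVneq u v; last first.
  rewrite mulr1; apply: le_trans (path_length_le_size _ _) _.
    by move=> x y; case: (x != y); rewrite ?ler01.
  by rewrite ler_nat ltnW // ltnS -(card_uniqP uniqq) max_card.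
case: q Pq lastq => [Pq _|w q Pq lastq].
  by rewrite Pq /path_length big_nil mulr0.
by move: uniqq; rewrite Pq cons_uniq uv -lastq /= mem_last.
Qed.

(** * Path systems made of progressions *)

Section PowerPaths.
Variables (gT : finGroupType) (r : gT -> gT) (e : gT -> nat).
Local Open Scope group_scope.

(** [r] and [e] select one way of writing each [g] as a power, in such a way that
[r g ^+ i] for [0 < i <= e g] is written as that very power, and that inversion
is respected.  These are the conditions under which the paths below are
consistent.  At [g = 1] the exponent is [0] and the root is arbitrary. *)
Definition power_factorization : Prop :=
  [/\ forall g, r g ^+ e g = g,
      forall g i, (i <= e g)%N -> e (r g ^+ i) = i,
      forall g i, (0 < i <= e g)%N -> r (r g ^+ i) = r g,
      forall g, e g^-1 = e g
    & forall g, (0 < e g)%N -> r g^-1 = (r g)^-1].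

Definition power_path : path_system gT := fun u v =>
  mkseq (fun i => u * r (u^-1 * v) ^+ i) (e (u^-1 * v)).+1.

Hypothesis re : power_factorization.

Lemma power_path_inj u g :
  {in gtn (e g).+1 &, injective (fun i => u * r g ^+ i)}.
Proof.
have [_ e_r _ _ _] := re => i j lei lej /mulgI eqij.
by rewrite -(e_r g i) // eqij e_r.
Qed.

(** When [e g = 0] the endpoints agree, and this case stands apart because
nothing then relates [r g] to [r g^-1]. *)
Lemma power_path_rev u v : power_path v u = rev (power_path u v).
Proof.
have [r_e e_r r_r eV rV] := re.
rewrite /power_path; set g := u^-1 * v.
have -> : v^-1 * u = g^-1 by rewrite invMg invgK.
have vE : v = u * g by rewrite mulKVg.
rewrite eV; have [e0|e_gt0] := posnP (e g).
  have g1 : g = 1 by rewrite -(r_e g) e0.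
  by rewrite e0 vE g1 invg1 mulg1.
rewrite rV //; apply: (@eq_from_nth _ 1) => [|i].
  by rewrite size_rev !size_mkseq.
rewrite size_mkseq => lti.
rewrite nth_rev size_mkseq // !nth_mkseq ?subSS //; last lia.
rewrite {1}vE -mulgA -{1}(r_e g); congr (_ * _).
by rewrite expgVn -{1}(subnK (_ : (i <= e g)%N)) // expgD mulgK.
Qed.

Lemma power_path_simple u v :
  simple_path (cayley_graph [set: gT]) u v (power_path u v).
Proof.
have [r_e _ _ _ _] := re.
exists (behead (power_path u v)); split.
- by rewrite /power_path /mkseq /= mulg1.
- move: (behead (power_path u v)) => q.
  elim: q u => [|w q IHq] u //=; rewrite IHq andbT.
  by apply/exists_inP; exists (u^-1 * w); rewrite ?inE // mulKVg.
- rewrite -[last _ _]/(last u (u :: behead (power_path u v))).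
  have -> : u :: behead (power_path u v) = power_path u v.
    by rewrite /power_path /mkseq /= mulg1.
  by rewrite /power_path mkseqS last_rcons r_e mulKVg.
- by apply/mkseq_uniqP; exact: power_path_inj.
Qed.

(** The vertices [u * r g ^+ i] and [u * r g ^+ j] differ by [r g ^+ (j - i)],
whose selected root is again [r g]. *)
Lemma power_path_subpath u v x y :
  x \in power_path u v -> y \in power_path u v ->
  subpath (power_path u v) x y = power_path x y.
Proof.
have [r_e e_r r_r _ _] := re.
case/mapP=> i; rewrite mem_iota add0n => /andP[_ lti] ->.
case/mapP=> j; rewrite mem_iota add0n => /andP[_ ltj] ->.
(* A subpath run backwards is the reversal of a forward one. *)
wlog leij: i j lti ltj / (i <= j)%N => [hw|].
  have [|/ltnW leji] := leqP i j; first exact: hw.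
  by rewrite subpath_sym hw // -power_path_rev.
rewrite /power_path subpath_mkseq ?leij //; last exact: power_path_inj.
set g := u^-1 * v in lti ltj *.
have -> : (u * r g ^+ i)^-1 * (u * r g ^+ j) = r g ^+ (j - i).
  by rewrite invMg mulgA mulgKV -{1}(subnKC leij) expgD mulKg.
rewrite e_r; last lia.
case: (posnP (j - i)) => [->|ltij]; first by rewrite /mkseq /= addn0 mulg1.
rewrite r_r ?ltij //=; last lia.
by apply: eq_mkseq => t; rewrite expgD mulgA.
Qed.

Lemma power_path_consistent :
  consistent_path_system (cayley_graph [set: gT]) power_path.
Proof.
split; [exact: power_path_simple | exact: power_path_rev |].
exact: power_path_subpath.
Qed.

Lemma power_path_invariant : invariant_path_system power_path.
Proof.
move=> g x y; rewrite /power_path /mkseq -map_comp.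
have -> : (g * x)^-1 * (g * y) = x^-1 * y by rewrite invMg mulgA mulgKV.
by apply: eq_map => i /=; rewrite mulgA.
Qed.

End PowerPaths.

(** * Averaging a metric over translations *)

Definition average (R : realType) (gT : finGroupType) (rho : gT -> gT -> R)
    (g : gT) : R := \sum_u rho u (u * g)%g.

Section Average.
Variables (R : realType) (gT : finGroupType) (rho : gT -> gT -> R).
Hypothesis rho_metric : is_metric rho.
Local Notation w := (average rho).

Lemma averageM g h : w (g * h)%g <= w g + w h.
Proof.
have [_ _ _ rhoD] := rho_metric.
rewrite /average [X in _ + X](reindex_inj (mulIg g)) -big_split /=.
by apply: ler_sum => u _; rewrite mulgA.
Qed.

Lemma averageV g : w g^-1%g = w g.
Proof.
have [_ _ rhoC _] := rho_metric.
rewrite /average (reindex_inj (mulIg g)) /=.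
by apply: eq_bigr => u _; rewrite mulgK rhoC.
Qed.

Lemma average_gt0 g : g != 1%g -> 0 < w g.
Proof.
have [rho0 rhoE _ _] := rho_metric => g_neq1.
rewrite /average (bigD1 1%g) //= ltr_wpDr ?sumr_ge0 // lt_neqAle rho0 andbT.
by rewrite eq_sym; apply: contra g_neq1 => /eqP/rhoE ->; rewrite mul1g.
Qed.

(** Each edge of the path from [u] to [u * g] is a translate of the pair
[(1, r g)], so summing its length over [u] contributes [w (r g)] once for each
of the [e g] edges. *)
Lemma average_power_path r e alpha g :
    (forall u v, path_length rho (power_path r e u v) <= alpha * rho u v) ->
  (e g)%:R * w (r g) <= alpha * w g.
Proof.
move=> le_alpha; rewrite /average.
apply: (@le_trans _ _ (\sum_u path_length rho (power_path r e u (u * g)%g))).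
  rewrite /power_path; under [leRHS]eq_bigr => u _ do
    rewrite mulKg path_length_mkseq.
  rewrite exchange_big /= mulr_natl -[e g in leLHS]subn0 -sumr_const_nat.
  rewrite le_eqVlt; apply/orP; left; apply/eqP.
  apply: eq_bigr => i _; rewrite (reindex_inj (mulIg (r g ^+ i)%g)) /=.
  by apply: eq_bigr => u _; rewrite expgSr mulgA.
rewrite mulr_sumr; apply: ler_sum => u _; exact: le_alpha.
Qed.

End Average.

(** * Progressions along independent rays *)

Section Rays.
Variables (gT : finGroupType) (A : {set gT}) (L : nat).
Local Open Scope group_scope.

Definition ray_factor (g : gT) : gT * nat :=
  if [pick zj : gT * 'I_L.+1 | (zj.1 \in A) && (g == zj.1 ^+ zj.2)] is Some zj
  then (zj.1, nat_of_ord zj.2) else (g, 1%N).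

Definition ray_root g := (ray_factor g).1.
Definition ray_exponent g := (ray_factor g).2.

(** Only the powers up to [L] are constrained: the cyclic groups generated by
different elements of [A] may meet, or even coincide, further out. *)
Definition independent_rays : Prop :=
  forall y z i j, y \in A -> z \in A -> (i <= L)%N -> (j <= L)%N ->
    y ^+ i = z ^+ j -> i = j /\ ((0 < i)%N -> y = z).

Hypotheses (A_neq0 : A != finset.set0) (AV : A^-1 = A).
Hypothesis indep : independent_rays.

Variant ray_spec g : gT -> nat -> Prop :=
| OnRay z j of z \in A & (j <= L)%N & g = z ^+ j : ray_spec g z j
| OffRay of (forall z j, z \in A -> (j <= L)%N -> g <> z ^+ j) :
    ray_spec g g 1.

Lemma rayP g : ray_spec g (ray_root g) (ray_exponent g).
Proof.
rewrite /ray_root /ray_exponent /ray_factor; case: pickP => [[z j]|noray] /=.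
  by case/andP=> Az /eqP; apply: OnRay => //; rewrite -ltnS.
apply: OffRay => z j Az lej gE.
by have := noray (z, Ordinal (lej : (j < L.+1)%N)); rewrite /= Az gE eqxx.
Qed.

Lemma ray_power z j : z \in A -> (j <= L)%N ->
  ray_exponent (z ^+ j) = j /\ ((0 < j)%N -> ray_root (z ^+ j) = z).
Proof.
move=> Az lej; case: rayP => [y i Ay lei eqzy|/(_ z j Az lej)//].
have [<- zy] := indep Az Ay lej lei eqzy.
by split=> // /zy.
Qed.

(** Nonemptiness of [A] puts [1] on a ray, so that its exponent is [0] and not
the [1] of an element outside the rays. *)
Lemma ray_factorization : power_factorization ray_root ray_exponent.
Proof.
have invA z : z \in A -> z^-1 \in A by rewrite -{2}AV inE invgK.
have e1 : ray_exponent 1 = 0%N.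
  by case/set0Pn: A_neq0 => z Az; have [] := ray_power Az (leq0n L).
have on g i : (i <= ray_exponent g)%N ->
    ray_exponent (ray_root g ^+ i) = i /\
    ((0 < i)%N -> ray_root (ray_root g ^+ i) = ray_root g).
  case: (ray_root g) (ray_exponent g) / (rayP g) => [z j Az lej _|noray] lei.
    exact: ray_power Az (leq_trans lei lej).
  case: i lei => [|[|//]] _; first by rewrite expg0 e1.
  rewrite expg1; case: rayP => // z j Az lej gE.
  by case: (noray z j Az lej).
have inv g : ray_exponent g^-1 = ray_exponent g /\
    ((0 < ray_exponent g)%N -> ray_root g^-1 = (ray_root g)^-1).
  case: (ray_root g) (ray_exponent g) / (rayP g) => [z j Az lej ->|noray].
    by rewrite -expgVn; exact: ray_power (invA _ Az) lej.
  case: rayP => // z j Az lej gE; case: (noray z^-1 j (invA _ Az) lej).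
  by rewrite expgVn -gE invgK.
split=> [g|g i /on[]|g i /andP[i_gt0 /on[_ ->]]|g|g e_gt0] //.
- by case: rayP => // z j _ _ ->.
- by case: (inv g).
- by case: (inv g) => _ ->.
Qed.

End Rays.

(** Both [x ^+ L] and [y ^+ L] are ends of paths with [L] edges, yet products of
two letters among [x], [y] and their inverses.  Neither bound suffices alone, as
the metric can make one of [x], [y] much longer than the other; their sum is
homogeneous in [w x + w y], which cancels. *)
Lemma le_Delta_rays (R : realType) (gT : finGroupType) (A : {set gT}) (L : nat)
    (x y : gT) :
    (A^-1)%g = A -> independent_rays A L -> x \in A -> y \in A ->
    x != 1%g -> (x ^+ L)%g = (y * x^-1)%g -> (y ^+ L)%g = (y^-1 * x^-1)%g ->
  L%:R / 2 <= Delta R (power_path (ray_root A L) (ray_exponent A L)).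
Proof.
move=> AV indep Ax Ay x1 xL yL.
have A_neq0 : A != finset.set0 by apply/set0Pn; exists x.
have fact := ray_factorization A_neq0 AV indep.
apply: (le_Delta (power_path_simple fact)) => a a1 [rho metric_rho le_a].
pose w := average rho.
have ray z : z \in A -> L%:R * w z <= a * w (z ^+ L)%g.
  move=> Az; have [L0|L_gt0] := posnP L.
    rewrite L0 mul0r mulr_ge0 //; first by rewrite (le_trans ler01).
    by apply: sumr_ge0 => u _; case: metric_rho.
  have [eL /(_ L_gt0) rL] := ray_power indep Az (leqnn L).
  rewrite -{1}eL -[in w z]rL; apply: average_power_path => //.
  by move=> u v; case/andP: (le_a u v).
have := ray x Ax; have := ray y Ay; rewrite xL yL.
have wyx : w (y * x^-1)%g <= w y + w x.
  by rewrite /w -(averageV metric_rho x); exact: averageM.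
have wyx' : w (y^-1 * x^-1)%g <= w y + w x.
  rewrite /w -(averageV metric_rho x) -(averageV metric_rho y).
  exact: averageM.
have wx : 0 < w x by exact: average_gt0.
have wy : 0 <= w y by apply: sumr_ge0 => u _; case: metric_rho.
have a0 : 0 <= a by rewrite (le_trans ler01).
have := ler_wpM2l a0 wyx; have := ler_wpM2l a0 wyx' => h1 h2 h3 h4.
rewrite -(ler_pM2r (_ : 0 < w x + w y)); last by rewrite ltr_pwDl.
lra.
Qed.

(** * The quarter turn of the integers modulo M^2 + 1 *)

Section QuarterTurn.
Variable M : nat.
Hypothesis M_gt1 : (1 < M)%N.
Local Notation n := (M ^ 2).+1.
Local Notation y := (M%:R : 'Z_n).

Lemma natr_quarter_turn_inj a b :
  (a < n)%N -> (b < n)%N -> a%:R = b%:R :> 'Z_n -> a = b.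
Proof.
have n_gt1 : (1 < n)%N by nia.
move=> lta ltb /(congr1 val) /=.
by rewrite !(val_Zp_nat n_gt1) !modn_small.
Qed.

Lemma quarter_turn_sqr : y ^+ 2 = -1.
Proof.
apply/eqP; rewrite -subr_eq0 opprK -natrX -[X in _ + X]/(1%:R) -natrD addn1.
by rewrite pchar_Zp //; nia.
Qed.

(** The integers [i], [M * j], [i + j] and [i + M * j] are all less than [n], so
the congruences [i = j], [i = M * j], [i = - j] and [i = - M * j] given by the
four values of [d] are equalities of integers; the last three force
[i = j = 0]. *)
Lemma quarter_turn_rays d i j : (d < 4)%N -> (i < M)%N -> (j < M)%N ->
  i%:R = y ^+ d * j%:R -> i = j /\ ((0 < i)%N -> d = 0%N).
Proof.
have y2 := quarter_turn_sqr; have y3 : y ^+ 3 = - y by rewrite exprS y2 mulrN1.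
move=> + ltiM ltjM; have leMj : (M * j <= M * M.-1)%N by rewrite leq_mul2l; lia.
have MM : (M ^ 2 = M * M.-1 + M)%N by nia.
(* When [j > 0], [M * j >= M > i], so that [i = M * j] is impossible. *)
have [j0|Mj] : j = 0%N \/ (M <= M * j)%N.
  by have [->|j_gt0] := posnP j; [left|right; rewrite leq_pmulr].
  rewrite j0 mulr0 -[0]/(0%:R) => _ /natr_quarter_turn_inj -> //; lia.
case: d => [|[|[|[|//]]]] _.
- by rewrite mul1r => /natr_quarter_turn_inj -> //; lia.
- rewrite expr1 -natrM => /natr_quarter_turn_inj; lia.
- rewrite y2 mulN1r => /eqP; rewrite -addr_eq0 -natrD -[0]/(0%:R) => /eqP.
  by move/natr_quarter_turn_inj; lia.
- rewrite y3 mulNr => /eqP; rewrite -addr_eq0 -natrM -natrD -[0]/(0%:R) => /eqP.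
  by move/natr_quarter_turn_inj; lia.
Qed.

Definition quarter_turns : {set 'Z_n} := [set y ^+ k | k : 'I_4].

Lemma quarter_turn4 : y ^+ 4 = 1.
Proof. by rewrite (exprM y 2 2) quarter_turn_sqr sqrrN expr1n. Qed.

Lemma mem_quarter_turns k : y ^+ k \in quarter_turns.
Proof.
rewrite (divn_eq k 4) exprD mulnC exprM quarter_turn4 expr1n mul1r.
by apply/imsetP; exists (Ordinal (ltn_pmod k (isT : (0 < 4)%N))).
Qed.

Lemma quarter_turnsV : (quarter_turns^-1)%g = quarter_turns.
Proof.
apply/eqP; rewrite finset.eqEsubset -{2}[quarter_turns]invgK invSg andbb.
apply/fintype.subsetP => _ /imsetP[k _ ->]; rewrite inE.
rewrite FinRing.zmodVgE -mulN1r -quarter_turn_sqr -exprD.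
exact: mem_quarter_turns.
Qed.

(** Turning both sides back by the smaller of the two exponents reduces the
sixteen pairs of rays to the four with one ray along [1]. *)
Lemma quarter_turns_independent : independent_rays quarter_turns M.-1.
Proof.
move=> _ _ i j /imsetP[a _ ->] /imsetP[b _ ->] lei lej.
have {lei} ltiM : (i < M)%N by lia.
have {lej} ltjM : (j < M)%N by lia.
rewrite !FinRing.zmodXgE -[_ *+ i]mulr_natr -[_ *+ j]mulr_natr.
case: a b => a /= lta [b /= ltb].
wlog leab : a b i j lta ltb ltiM ltjM / (a <= b)%N => [hw|].
  have [|/ltnW leba] := leqP a b; first exact: hw.
  by move/esym/hw => /(_ ltb lta ltjM ltiM leba)[-> ab]; split=> // /ab.
move/(congr1 (fun z => y ^+ (4 - a) * z)); rewrite !mulrA -!exprD.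
have -> : (4 - a + b = 4 + (b - a))%N by lia.
rewrite (subnK (ltnW lta)).
rewrite exprD quarter_turn4 !mul1r => eq_ij.
have ltd : (b - a < 4)%N by lia.
have [-> ba] := quarter_turn_rays ltd ltiM ltjM eq_ij.
by split=> // /ba b_a; congr (y ^+ _); lia.
Qed.

End QuarterTurn.

Theorem theorem4p1 (R : realType) :
  exists c k : R, [/\ 0 < c, 0 <= k &
    forall N : nat, exists2 n : nat, (N < n)%N &
      exists (G : finGroupType) (S : {set G}) (P : path_system G),
        [/\ #|G| = n,
            symmetric_generating_set S,
            consistent_path_system (cayley_graph S) P,
            invariant_path_system P
          & c * Num.sqrt n%:R / ln n%:R `^ k <= Delta R P]].
Proof.
exists (4^-1), 0; split=> [||N]; rewrite ?invr_gt0 //.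
pose M := N.+3; have M_gt1 : (1 < M)%N by [].
have n_gt1 : (1 < (M ^ 2).+1)%N by rewrite ltnS expn_gt0.
exists (M ^ 2).+1; first by rewrite /M; nia.
have indep := quarter_turns_independent M_gt1.
have AV := quarter_turnsV M_gt1.
have Ax : 1 \in quarter_turns M := mem_quarter_turns M_gt1 0.
have Ay : M%:R \in quarter_turns M.
  by rewrite -[M%:R]expr1 mem_quarter_turns.
have A_neq0 : quarter_turns M != finset.set0 by apply/set0Pn; exists 1.
have fact := ray_factorization A_neq0 AV indep.
exists 'Z_((M ^ 2).+1), [set: _],
  (power_path (ray_root (quarter_turns M) M.-1)
              (ray_exponent (quarter_turns M) M.-1)); split.
- by rewrite card_ord Zp_cast.
- by split; [apply/setP => g; rewrite !inE | rewrite genGid].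
- exact: power_path_consistent.
- exact: power_path_invariant.
have M1 : (M.-1)%:R = M%:R - 1 :> 'Z_((M ^ 2).+1) by rewrite -subn1 natrB.
rewrite powRr0 divr1; apply: le_trans (le_Delta_rays R AV indep Ax Ay _ _ _).
(* The constant [4^-1] comes from [M ^ 2 + 1 <= (2 * (M - 1)) ^ 2]. *)
- have : Num.sqrt (M ^ 2).+1%:R <= 2 * (M.-1)%:R :> R; last by lra.
  rewrite -[leRHS]ger0_norm ?mulr_ge0 // -sqrtr_sqr ler_wsqrtr //.
  by rewrite -natrM -natrX ler_nat /M; nia.
- exact: oner_neq0.
- by rewrite FinRing.zmodXgE FinRing.zmodMgE FinRing.zmodVgE M1.
- rewrite FinRing.zmodXgE FinRing.zmodMgE !FinRing.zmodVgE.
  by rewrite -[_ *+ M.-1]mulr_natr M1 mulrBr mulr1 -expr2 quarter_turn_sqr // addrC.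
Qed.
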